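(* Let $t\geq 1$ be an integer. If $G$ is a connected $K_{2,t}$-minor-free graph, then $c(G)\leq \left\lceil\frac{t+1}{2}\right\rceil$.
   Context: All graphs are finite and simple. $K_{s,t}$ is the complete bipartite graph with parts of sizes $s$ and $t$. A graph $G$ is $H$-minor-free if no graph isomorphic to $H$ can be obtained from $G$ by deleting vertices, deleting edges and contracting edges. Cop number: in the game of cops and robbers on $G$, one player places $m$ cops on (not necessarily distinct) vertices, then the other player places the robber on a vertex. Then, starting with the cops, the players alternate turns; on a turn, a player may move any of their pieces to an adjacent vertex (each piece moves at most once, and any piece may stay put). The cops win if at some point some cop occupies the same vertex as the robber; the robber wins by evading capture forever. The cop number $c(G)$ is the minimum $m$ such that the cops have a winning strategy. *)

(* Defs.v *)
From HB Require Import structures.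
From mathcomp Require Import all_boot.
From mathcomp Require Import boolp.

Set Implicit Arguments.
Unset Strict Implicit.
Unset Printing Implicit Defensive.

Record sgraph := SGraph {
  vertex :> finType;
  edge : rel vertex;
  edge_sym : symmetric edge;
  edge_irr : irreflexive edge }.

Arguments edge {s} : rename.
Notation "x -- y" := (edge x y) (at level 30) : bool_scope.

Definition connected_graph (G : sgraph) : Prop :=
  forall x y : G, connect edge x y.

Definition isomorphic (G H : sgraph) : Prop :=
  exists2 f : G -> H, bijective f & forall x y, f x -- f y = x -- y.

Section CompleteBipartite.
Variables s t : nat.

Definition Kst_edge (x y : 'I_s + 'I_t) : bool :=
  match x, y with
  | inl _, inr _ | inr _, inl _ => true
  | _, _ => false
  end.

Lemma Kst_sym : symmetric Kst_edge.
Proof. by move=> [?|?] [?|?]. Qed.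

Lemma Kst_irr : irreflexive Kst_edge.
Proof. by case. Qed.

Definition complete_bipartite : sgraph := SGraph Kst_sym Kst_irr.

End CompleteBipartite.

Section MinorOperations.
Variable G : sgraph.

Definition del_vertex_edge (v : G) : rel {x : G | x != v} :=
  fun a b => val a -- val b.

Lemma del_vertex_sym v : symmetric (@del_vertex_edge v).
Proof. by move=> a b; exact: edge_sym. Qed.

Lemma del_vertex_irr v : irreflexive (@del_vertex_edge v).
Proof. by move=> a; exact: edge_irr. Qed.

Definition del_vertex (v : G) : sgraph :=
  SGraph (@del_vertex_sym v) (@del_vertex_irr v).

Definition del_edge_edge (u v : G) : rel G :=
  fun a b => a -- b && ~~ ((a == u) && (b == v) || (a == v) && (b == u)).

Lemma del_edge_sym u v : symmetric (del_edge_edge u v).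
Proof.
move=> a b; rewrite /del_edge_edge edge_sym.
by rewrite [(b == u) && _]andbC [(b == v) && _]andbC orbC.
Qed.

Lemma del_edge_irr u v : irreflexive (del_edge_edge u v).
Proof. by move=> a; rewrite /del_edge_edge edge_irr. Qed.

Definition del_edge (u v : G) : sgraph :=
  SGraph (@del_edge_sym u v) (@del_edge_irr u v).

(* The vertex [v] is merged into [u], which represents the contracted edge;
   loops and parallel edges are discarded, so the result is simple. *)
Definition contract_edge_edge (u v : G) : rel {x : G | x != v} :=
  fun a b => (a != b) &&
    [|| val a -- val b, (val a == u) && v -- val b
      | (val b == u) && v -- val a].

Lemma contract_edge_sym u v : symmetric (@contract_edge_edge u v).
Proof.
move=> a b; rewrite /contract_edge_edge eq_sym (edge_sym (val a)).
by congr (_ && (_ || _)); rewrite orbC.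
Qed.

Lemma contract_edge_irr u v : irreflexive (@contract_edge_edge u v).
Proof. by move=> a; rewrite /contract_edge_edge eqxx. Qed.

Definition contract_edge (u v : G) : sgraph :=
  SGraph (@contract_edge_sym u v) (@contract_edge_irr u v).

End MinorOperations.

Inductive has_minor (H : sgraph) : sgraph -> Prop :=
| minor_iso (G : sgraph) : isomorphic G H -> has_minor H G
| minor_del_vertex (G : sgraph) (v : G) :
    has_minor H (del_vertex v) -> has_minor H G
| minor_del_edge (G : sgraph) (u v : G) :
    u -- v -> has_minor H (del_edge u v) -> has_minor H G
| minor_contract_edge (G : sgraph) (u v : G) :
    u -- v -> has_minor H (contract_edge u v) -> has_minor H G.

Definition minor_free (H G : sgraph) : Prop := ~ has_minor H G.

Section CopsAndRobber.
Variable G : sgraph.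

Definition legal_move (x y : G) : bool := (x == y) || x -- y.

(* A strategy for [m] cops maps the list of the robber's positions so far,
   oldest first, to the cops' positions: [sigma [::]] is the initial placement,
   and [sigma [:: r0; ...; rn]] is the position after the cops' reply to [rn].
   The earlier positions of the cops need not be an argument, since [sigma]
   already determines them. *)
Definition cop_strategy (m : nat) : Type := seq G -> {ffun 'I_m -> G}.

Definition legal_strategy m (sigma : cop_strategy m) : Prop :=
  forall (h : seq G) (r : G) (i : 'I_m),
    legal_move (sigma h i) (sigma (rcons h r) i).

(* [rho 0] is the robber's initial vertex, [rho n] its position after n turns.
   Quantifying over all legal [rho] accounts for every robber strategy, since
   the play against a fixed [sigma] is determined by [rho]. *)
Definition legal_robber (rho : nat -> G) : Prop :=
  forall n, legal_move (rho n) (rho n.+1).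

(* A capture happens either on a robber's turn (or placement) or on the cops'
   next turn. *)
Definition captures m (sigma : cop_strategy m) (rho : nat -> G) : Prop :=
  exists (n : nat) (i : 'I_m),
    sigma (mkseq rho n) i = rho n \/ sigma (mkseq rho n.+1) i = rho n.

Definition cops_win (m : nat) : Prop :=
  exists2 sigma : cop_strategy m, legal_strategy sigma &
    forall rho, legal_robber rho -> captures sigma rho.

Lemma cops_win_card : cops_win #|G|.
Proof.
exists (fun _ => [ffun i => enum_val i]).
  by move=> h r i; rewrite /legal_move eqxx.
move=> rho _; exists 0, (enum_rank (rho 0)); left.
by rewrite ffunE enum_rankK.
Qed.

Lemma ex_cops_win : exists m, `[< cops_win m >].
Proof. by exists #|G|; apply/asboolP; exact: cops_win_card. Qed.

Definition cop_number : nat := ex_minn ex_cops_win.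

End CopsAndRobber.

(* Main.v *)
Require Import Defs.
From mathcomp Require Import all_boot.
From mathcomp Require Import boolp zify.

(* Let [K] be the number of cops, so that [t <= 2K - 1].  The robber is confined
   to a connected territory [C]; every vertex of its boundary is protected by a
   cop, and we induct on [#|C|].  Outside [C] there is a connected "center" [A],
   and each cop [j] owns a path [s j], the paths being disjoint from each other
   and from [A] and [C].  All of them have both ends attached to [A], except
   that of one cop [j0], which need only be attached at one end.
   If [s j] contains no boundary vertex, then cop [j] is free to protect a
   geodesic through [C] between two given boundary vertices.  If [s j] contains
   exactly one, say [q], then cop [j] can move to [q] and from there occupy a
   geodesic starting at [q] without ever unprotecting [q].  Either way the
   territory shrinks.  Otherwise each [s j] with [j != j0] can be cut into two
   connected pieces adjacent to both [C] and [A]; with [s j0] this gives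
   [2K - 1] leaves, and contracting them, [C] and [A] yields a K_{2,2K-1} minor. *)

Set Implicit Arguments.
Unset Strict Implicit.
Unset Printing Implicit Defensive.

Lemma connect_homo (T T' : finType) (e : rel T) (e' : rel T') (g : T -> T') :
  (forall x y, e x y -> connect e' (g x) (g y)) ->
  forall x y, connect e x y -> connect e' (g x) (g y).
Proof.
move=> eg x y /connectP[p + ->]; elim: p x => //= z p IH x /andP[exz pzp].
exact: connect_trans (eg _ _ exz) (IH _ pzp).
Qed.

(** * Minors from branch sets *)

Section Models.
Variable H : sgraph.

Definition fiber (G : sgraph) (f : G -> option H) (h : H) : rel G :=
  [rel x y | [&& x -- y, f x == Some h & f y == Some h]].

Record minor_model (G : sgraph) (f : G -> option H) : Prop := MinorModel {
  model_surj : forall h, exists x, f x = Some h;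
  model_conn : forall h x y, f x = Some h -> f y = Some h ->
    connect (fiber f h) x y;
  model_edge : forall h h', h -- h' ->
    exists x y, [/\ f x = Some h, f y = Some h' & x -- y] }.

(** Induct on the number of edges: an edge of [G] whose image is not an edge of [H] can be deleted;
    once there is none, [f] is an isomorphism. *)
Lemma minor_spanning (G : sgraph) (f : G -> H) :
  bijective f -> (forall x y, f x -- f y -> x -- y) -> has_minor H G.
Proof.
have [n] := ubnP #|[set p : G * G | p.1 -- p.2]|.
elim: n => // n IH in G f *; rewrite ltnS => leGn bij_f sub_f.
case: (pickP (fun p : G * G => (p.1 -- p.2) && ~~ (f p.1 -- f p.2))); last first.
  move=> eq_f; apply: minor_iso; exists f => // x y.
  apply/idP/idP => [/sub_f //|xy].
  by move: (eq_f (x, y)); rewrite /= xy /= => /negbFE.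
case=> u v /= /andP[uv fuv].
apply: (minor_del_edge uv); apply: (IH (del_edge u v) f) => //.
  apply: leq_trans leGn; apply/proper_card/properP; split.
    by apply/subsetP=> -[x y]; rewrite !inE /= => /andP[].
  exists (u, v); rewrite inE //= /edge /= /del_edge_edge negb_and negbK.
  by rewrite !eqxx orbT.
move=> x y fxy; rewrite /edge /= /del_edge_edge sub_f //=.
apply/negP => /orP[] /andP[/eqP xE /eqP yE]; subst x y.
  by rewrite fxy in fuv.
by rewrite edge_sym fxy in fuv.
Qed.

(** Induct on the number of vertices: delete a vertex in no branch set, or contract an edge inside
    one. If neither is possible, every branch set is connected without edges, hence a single vertex,
    and [minor_spanning] applies. *)
Lemma minor_of_model (G : sgraph) (f : G -> option H) :
  minor_model f -> has_minor H G.
Proof.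
have [n] := ubnP #|G|; elim: n => // n IH in G f *; rewrite ltnS => leGn.
have card_del (v : G) : #|{: {x : G | x != v}}| < n.
  apply: leq_trans leGn; rewrite card_sig (cardD1 v G) inE add1n ltnS.
  by apply/subset_leq_card/subsetP=> x; rewrite !inE andbT.
case=> surj_f conn_f edge_f.
case: (pickP (fun v => f v == None)) => [v /eqP fv|f_some].
  apply: (minor_del_vertex (v := v)).
  have nv x h : f x = Some h -> x != v.
    by move=> fx; apply/eqP => xv; rewrite xv fv in fx.
  apply: (IH (del_vertex v) (fun a => f (val a))); first exact: card_del.
  split=> [h|h x y fx fy|h h' /edge_f[x [y [fx fy xy]]]].
  - by have [x fx] := surj_f h; exists (Sub x (nv _ _ fx)).
  - have hom a b : fiber f h a b ->
        connect (fiber (fun c : del_vertex v => f (val c)) h)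
          (insubd x a) (insubd x b).
      move=> /and3P[ab /eqP fa /eqP fb]; apply: connect1; rewrite /fiber /=.
      have [va vb] := (nv _ _ fa, nv _ _ fb).
      rewrite /edge /= /del_vertex_edge !val_insubd va vb ab fa fb.
      by rewrite !eqxx.
    by have := connect_homo hom (conn_f h _ _ fx fy); rewrite !valKd.
  - by exists (Sub x (nv _ _ fx)), (Sub y (nv _ _ fy)).
case: (pickP (fun p : G * G => (p.1 -- p.2) && (f p.1 == f p.2))).
  case=> u v /= /andP[uv /eqP fuv]; apply: (minor_contract_edge uv).
  have unv : u != v by apply/eqP => E; rewrite E edge_irr in uv.
  pose u' : contract_edge u v := Sub u unv.
  (* The default [u'] makes [pr] the quotient map, sending [v] to [u]. *)
  pose pr (x : G) : contract_edge u v := insubd u' x.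
  have prE x : val (pr x) = if x != v then x else u by rewrite val_insubd.
  have fpr x : f (val (pr x)) = f x.
    by rewrite prE; case: eqP => //= ->.
  have edge_pr x y : x -- y -> pr x != pr y -> pr x -- pr y.
    move=> xy npr; rewrite /edge /= /contract_edge_edge npr !prE /=.
    case: (x =P v) xy => [->|_]; case: (y =P v) => [->|_] //=.
    - by rewrite edge_irr.
    - by move=> ->; rewrite eqxx orbT.
    - by rewrite edge_sym => ->; rewrite eqxx !orbT.
    - by move=> ->.
  apply: (IH (contract_edge u v) (fun a => f (val a))); first exact: card_del.
  split=> [h|h x y fx fy|h h' hh'].
  - by have [x fx] := surj_f h; exists (pr x); rewrite fpr.
  - have hom a b : fiber f h a b ->
        connect (fiber (fun c : contract_edge u v => f (val c)) h)
          (pr a) (pr b).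
      move=> /and3P[ab fa fb]; have [->//|npr] := eqVneq (pr a) (pr b).
      by apply: connect1; apply/and3P; rewrite !fpr; split=> //; exact: edge_pr.
    by have := connect_homo hom (conn_f h _ _ fx fy); rewrite /pr !valKd.
  - have [x [y [fx fy xy]]] := edge_f _ _ hh'.
    exists (pr x), (pr y); rewrite !fpr; split=> //; apply: edge_pr => //.
    apply/eqP => E; have := fpr x; rewrite E fpr fx fy => -[E'].
    by rewrite E' edge_irr in hh'.
move=> no_edge.
have inj_f : injective f.
  move=> x y fxy; case fx: (f x) => [h|]; last by have := f_some x; rewrite fx.
  have /connectP[[|z p] /=] := conn_f h x y fx (etrans (esym fxy) fx).
    by move=> _ ->.
  case/andP=> /and3P[xz fxh fzh] _ _.
  by have := no_edge (x, z); rewrite /= xz (eqP fxh) (eqP fzh) eqxx.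
have /choice[g gf] : forall x, exists h, f x = Some h.
  by move=> x; case fx: (f x) => [h|]; [exists h | have := f_some x; rewrite fx].
have inj_g : injective g by move=> x y E; apply: inj_f; rewrite !gf E.
apply: (@minor_spanning G g) => [|x y /edge_f[x' [y' [fx fy xy]]]].
  apply: inj_card_bij => //; have [k kf] := choice surj_f.
  suff inj : injective k by exact: leq_card inj.
  by move=> h h' E; have := kf h; rewrite E kf => -[].
by rewrite (inj_f x x') 1?(inj_f y y') // gf.
Qed.

End Models.

(** * Connected sets, boundaries, tails and ears *)

Section Connectivity.
Variable G : sgraph.
Implicit Types (A C D S : {set G}) (s : seq G).

Definition inside S : rel G := [rel x y | [&& x -- y, x \in S & y \in S]].

Definition conn S : Prop :=
  forall x y, x \in S -> y \in S -> connect (inside S) x y.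

Definition boundary C : {set G} := [set v | v \notin C & [exists u in C, u -- v]].

Definition adjacent S S' : Prop := exists x y, [/\ x \in S, y \in S' & x -- y].

Lemma inside_sym S : connect_sym (inside S).
Proof.
apply: sym_connect_sym => x y; rewrite /inside /= edge_sym.
by rewrite [(y \in S) && _]andbC.
Qed.

Lemma connect_sub_inside S S' x y :
  S \subset S' -> connect (inside S) x y -> connect (inside S') x y.
Proof.
move=> /subsetP sSS'; apply: (connect_homo (g := id)) => a b /and3P[ab aS bS].
by apply: connect1; rewrite /inside /= ab !sSS'.
Qed.

Lemma conn1 x : conn [set x].
Proof. by move=> a b /set1P-> /set1P->. Qed.

Lemma conn_add A a b : conn A -> a \in A -> a -- b -> conn (b |: A).
Proof.
move=> cA aA ab.
have ba: connect (inside (b |: A)) a b.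
  by apply: connect1; rewrite /inside /= ab !inE eqxx aA orbT.
have toa x : x \in b |: A -> connect (inside (b |: A)) x a.
  case/setU1P => [->|xA]; first by rewrite inside_sym.
  exact: connect_sub_inside (subsetUr _ _) (cA _ _ xA aA).
move=> x y xA yA; apply: connect_trans (toa x xA) _.
by rewrite inside_sym; exact: toa.
Qed.

Definition tail A s : Prop := exists2 a, a \in A & path edge a s.
Definition ear A s : Prop :=
  exists a b, [/\ a \in A, b \in A & path edge a (rcons s b)].

Lemma earS A A' s : A \subset A' -> ear A s -> ear A' s.
Proof. by move=> /subsetP sA [a [b [aA bA p]]]; exists a, b; split=> //; exact: sA. Qed.

Lemma path_edge_rev a s b : path edge a (rcons s b) -> path edge b (rcons (rev s) a).
Proof.
have := rev_path edge a (rcons s b); rewrite last_rcons belast_rcons rev_cons => ->.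
by apply: sub_path => x y; rewrite edge_sym.
Qed.

Lemma ear_rev A s : ear A s -> ear A (rev s).
Proof. by move=> [a [b [aA bA p]]]; exists b, a; split=> //; exact: path_edge_rev. Qed.

Lemma ear_tail A s1 s2 : ear A (s1 ++ s2) -> tail A s1.
Proof.
by move=> [a [b [aA _]]]; rewrite rcons_cat cat_path => /andP[p _]; exists a.
Qed.

Lemma tail_catl A s1 s2 : tail A (s1 ++ s2) -> tail A s1.
Proof. by move=> [a aA]; rewrite cat_path => /andP[p _]; exists a. Qed.

Lemma conn_tail A s : conn A -> tail A s -> conn (A :|: [set x in s]).
Proof.
elim: s A => [|b s IH] A cA [a aA] /=; first by rewrite set_nil setU0.
case/andP=> ab ps; rewrite set_cons setUA [A :|: _]setUC.
by apply: IH; [exact: conn_add aA ab | exists b; rewrite // setU11].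
Qed.

Lemma conn_path x s : path edge x s -> conn [set y in x :: s].
Proof.
by move=> p; rewrite set_cons; apply: conn_tail; [exact: conn1 | exists x; rewrite ?set11].
Qed.

Lemma minor_of_branch_sets (H : sgraph) (B : H -> {set G}) :
  (forall h, B h != set0) -> (forall h, conn (B h)) ->
  (forall h h' x, x \in B h -> x \in B h' -> h = h') ->
  (forall h h', h -- h' -> adjacent (B h) (B h')) -> has_minor H G.
Proof.
move=> B0 cB dB eB; pose f x := [pick h | x \in B h].
have fE h x : (f x == Some h) = (x \in B h).
  rewrite /f; case: pickP => [h' xh'|/(_ h)/= ->]; last by [].
  apply/eqP/idP => [[<-]//|xh]; congr Some; exact: dB xh' xh.
apply: (@minor_of_model _ _ f); split=> [h|h x y|h h' /eB[x [y [xh yh xy]]]].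
- by have /set0Pn[x xh] := B0 h; exists x; apply/eqP; rewrite fE.
- move=> /eqP; rewrite fE => xh /eqP; rewrite fE => yh.
  rewrite (eq_connect (e' := inside (B h))) ?cB // => a b.
  by rewrite /fiber /inside /= !fE.
- by exists x, y; split=> //; apply/eqP; rewrite fE.
Qed.

(** [C] and [A] contract to the two vertices of one side, and any [t] of the leaves to the other
    side. *)
Lemma K2t_minor (I : finType) (P : {pred I}) (leaf : I -> {set G}) t C A :
  t <= #|P| -> C != set0 -> A != set0 -> conn C -> conn A -> [disjoint C & A] ->
  (forall i, i \in P -> [/\ conn (leaf i), [disjoint leaf i & C :|: A],
     adjacent (leaf i) C & adjacent (leaf i) A]) ->
  (forall i j x, i \in P -> j \in P -> x \in leaf i -> x \in leaf j -> i = j) ->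
  has_minor (complete_bipartite 2 t) G.
Proof.
move=> tP C0 A0 cC cA dCA leafP dleaf.
pose g (j : 'I_t) : I := enum_val (widen_ord tP j).
have gP j : g j \in P by exact: enum_valP.
have g_inj : injective g by move=> i j /enum_val_inj/(congr1 val)/= /val_inj.
pose B (h : complete_bipartite 2 t) :=
  match h with inl i => if i == ord0 then C else A | inr j => leaf (g j) end.
have adj_sym S S' : adjacent S S' -> adjacent S' S.
  by move=> [x [y [xS yS xy]]]; exists y, x; split; rewrite // edge_sym.
have leaf_notin j x (i : 'I_2) :
    x \in leaf (g j) -> x \in (if i == ord0 then C else A) -> False.
  move=> xj xi; have [_ d _ _] := leafP _ (gP j).
  have := disjointFr d xj; rewrite inE; move: xi.
  by case: (i == ord0) => -> //; rewrite orbT.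
apply: (@minor_of_branch_sets _ B) => [[i|j]|[i|j]|[i|j] [i'|j'] x|[i|j] [i'|j']] //=.
- by case: ifP.
- have [_ _ [x [_ [xj _ _]]] _] := leafP _ (gP j).
  by apply/set0Pn; exists x.
- by case: ifP.
- by have [] := leafP _ (gP j).
- move: i i' => [[|[|//]] ?] [[|[|//]] ?] //=; rewrite -?val_eqE /=.
  + by move=> _ _; congr inl; apply: val_inj.
  + by move=> xC; rewrite (disjointFr dCA xC).
  + by move=> xA xC; rewrite (disjointFr dCA xC) in xA.
  + by move=> _ _; congr inl; apply: val_inj.
- by move=> xi xj; case: (leaf_notin _ _ _ xj xi).
- by move=> xj /(leaf_notin _ _ _ xj).
- by move=> xj xj'; congr inr; apply: g_inj; exact: dleaf xj xj'.
- by move=> _; have [_ _ ? ?] := leafP _ (gP j'); case: ifP => _; exact: adj_sym.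
- by move=> _; have [_ _ ? ?] := leafP _ (gP j); case: ifP => _.
Qed.

End Connectivity.

(** * The minor obtained by cutting ears *)

Section EarsMinor.
Variables (G : sgraph) (K t : nat) (C A : {set G}) (s : 'I_K -> seq G) (j0 : 'I_K).

Lemma tail_leaf (p : seq G) (v : G) :
  tail A p -> v \in p -> v \in boundary C ->
  [/\ conn [set y in p], adjacent [set y in p] C & adjacent [set y in p] A].
Proof.
case: p => // x p [a aA] /= /andP[ax pp] vp.
rewrite inE => /andP[_ /existsP[u /andP[uC uv]]]; split; first exact: conn_path pp.
  by exists v, u; rewrite inE edge_sym.
by exists x, a; rewrite inE mem_head edge_sym.
Qed.

(** The cut is right after the first boundary vertex. The first piece holds that vertex and starts
    next to [A]; the second holds another one and ends next to [A], so its reversal is a tail. *)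
Lemma ear_leaves (p : seq G) (k := (find [in boundary C] p).+1) :
  ear A p -> 1 < count [in boundary C] p ->
  [/\ conn [set y in take k p], adjacent [set y in take k p] C &
      adjacent [set y in take k p] A] /\
  [/\ conn [set y in drop k p], adjacent [set y in drop k p] C &
      adjacent [set y in drop k p] A].
Proof.
move=> ep cp.
have [v [p1 [p2 [defp vC np1]]]] : exists v p1 p2,
    [/\ p = rcons p1 v ++ p2, v \in boundary C & ~~ has [in boundary C] p1].
  have : has [in boundary C] p by rewrite has_count; exact: leq_trans cp.
  by case/split_find => v p1 p2 vC np1; exists v, p1, p2.
have kE : k = size (rcons p1 v).
  rewrite /k defp cat_rcons find_cat (negbTE np1) /= vC addn0 size_rcons //.
rewrite kE {1 2 3}defp take_size_cat // {1 2 3}defp drop_size_cat //.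
rewrite defp in ep cp; split.
  apply: (tail_leaf (v := v)) vC; first exact: ear_tail ep.
  by rewrite mem_rcons mem_head.
have /hasP[w wp2 wC] : has [in boundary C] p2.
  move: cp; rewrite count_cat -cats1 count_cat has_count /=.
  by move: np1; rewrite has_count -eqn0Ngt => /eqP->; rewrite vC addn0 ltnS.
have rE : [set y in p2] = [set y in rev p2] by apply/setP => y; rewrite !inE mem_rev.
rewrite rE; apply: (tail_leaf (v := w)); rewrite ?mem_rev //.
by move/ear_rev: ep; rewrite rev_cat; exact: ear_tail.
Qed.

Lemma ears_minor :
  t <= (2 * K).-1 -> C != set0 -> A != set0 -> conn C -> conn A ->
  [disjoint C & A] -> (forall j, uniq (s j)) ->
  (forall j v, v \in s j -> v \notin C :|: A) ->
  (forall i j v, v \in s i -> v \in s j -> i = j) ->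
  tail A (s j0) -> has [in boundary C] (s j0) ->
  (forall j, j != j0 -> ear A (s j) /\ 1 < count [in boundary C] (s j)) ->
  has_minor (complete_bipartite 2 t) G.
Proof.
move=> tK C0 A0 cC cA dCA us ds djs tj0 hj0 earP.
pose k j := (find [in boundary C] (s j)).+1.
(* Both [(j0, true)] and [(j0, false)] stand for the uncut [s j0]; leaving out [(j0, false)] gives
   [2 * K - 1] distinct leaves. *)
pose part (p : 'I_K * bool) :=
  if p.1 == j0 then s j0 else if p.2 then take (k p.1) (s p.1) else drop (k p.1) (s p.1).
have part_sub p v : v \in part p -> v \in s p.1.
  rewrite /part; case: eqP => [->//|_]; case: p.2 => /=; [exact: mem_take | exact: mem_drop].
apply: (@K2t_minor _ _ [pred p | p != (j0, false)] (fun p => [set y in part p]) t C A) => //.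
- by rewrite cardC1 card_prod card_ord card_bool mulnC.
- move=> [j b]; rewrite inE => jb.
  have ndis : [disjoint [set y in part (j, b)] & C :|: A].
    apply/pred0P => y; apply/negbTE; rewrite /= inE negb_and.
    case: (boolP (y \in part (j, b))) => //= /part_sub; exact: ds.
  suff [? ? ?] : [/\ conn [set y in part (j, b)], adjacent [set y in part (j, b)] C
    & adjacent [set y in part (j, b)] A] by [].
  rewrite /part /=; case: eqVneq => [E|nj].
    by have /hasP[v vs vC] := hj0; exact: tail_leaf vs vC.
  have [ej cj] := earP _ nj.
  by have [? ?] := ear_leaves ej cj; case: ifP.
- move=> [i b] [j b'] v; rewrite !inE => ib jb vi vj.
  have /= E := djs _ _ _ (part_sub _ _ vi) (part_sub _ _ vj); subst j.
  congr pair; move: vi vj ib jb; rewrite /part /=; case: eqVneq => [-> _ _|_].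
    by case: b; case: b'; rewrite ?eqxx.
  have := us i; rewrite -{1}(cat_take_drop (k i) (s i)) cat_uniq => /and3P[_ /hasPn h _].
  by case: b; case: b' => // v1 v2; [have := h _ v2 | have := h _ v1]; rewrite /= ?v1 ?v2.
Qed.

End EarsMinor.

(** * Shadows of the robber *)

Section Game.
Variables (G : sgraph) (K : nat).
Implicit Types (C D : {set G}) (f g : G -> G) (F : 'I_K -> G -> G) (X Y : pred G).
Implicit Types (c : {ffun 'I_K -> G}) (r : G).

Lemma legal_sym : symmetric (@legal_move G).
Proof. by move=> x y; rewrite /legal_move eq_sym edge_sym. Qed.

(** It is the cops' turn, and [n] bounds the number of their moves until capture. A robber who steps
    onto a cop is captured by that cop staying put. *)
Fixpoint win_in n c r : Prop :=
  if n is n'.+1 then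
    exists2 c' : {ffun 'I_K -> G}, forall i, legal_move (c i) (c' i) &
      (forall i, c' i <> r) -> forall r', legal_move r r' -> win_in n' c' r'
  else False.

Lemma win_inS m n c r : m <= n -> win_in m c r -> win_in n c r.
Proof.
elim: m n c r => [|m IH] [|n] c r //=; rewrite ltnS => mn [c' lc' wc'].
by exists c' => // nc r' lr'; exact: IH (wc' nc _ lr').
Qed.

Definition wins c r : Prop := exists n, win_in n c r.

(** The robber has finitely many replies, so the bounds for them have a maximum. *)
Lemma wins_step c c' r : (forall i, legal_move (c i) (c' i)) ->
  (forall r', legal_move r r' -> wins c' r') -> wins c r.
Proof.
move=> lc' wc'.
have /choice[k kP] : forall r', exists n, legal_move r r' -> win_in n c' r'.
  by move=> r'; case: (pselect (legal_move r r')) => [/wc'[n] | ]; [exists n | exists 0].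
exists (\max_r' k r').+1, c' => // _ r' lr'.
exact: win_inS (leq_bigmax r') (kP _ lr').
Qed.

Lemma wins_capture c r i : legal_move (c i) r -> wins c r.
Proof.
move=> ci; exists 1, [ffun i' => if i' == i then r else c i'] => [i'|].
  by rewrite ffunE; case: eqP => [->//|_]; rewrite /legal_move eqxx.
by move=> /(_ i); rewrite ffunE eqxx.
Qed.

(** In a winning position the strategy plays the first move of a fastest win. This move depends only
    on the position and lowers every valid bound [n.+1] to [n], so the bound for the initial
    position forces a capture. *)
Lemma cops_win_of_wins c0 : (forall r, wins c0 r) -> cops_win G K.
Proof.
move=> win0.
have /choice[step stepP] : forall p : {ffun 'I_K -> G} * G, exists c' : {ffun 'I_K -> G},
    (forall i, legal_move (p.1 i) (c' i)) /\
    forall n, win_in n.+1 p.1 p.2 -> (forall i, c' i <> p.2) ->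
    forall r', legal_move p.2 r' -> win_in n c' r'.
  move=> [c r] /=; case: (pselect (wins c r)) => [w|nw]; last first.
    exists c; split=> [i|n wn]; first by rewrite /legal_move eqxx.
    by case: nw; exists n.+1.
  have /ex_minnP[[|m] /asboolP // [c' lc' wc'] min_m] :
      exists n, `[< win_in n c r >] by have [n wn] := w; exists n; apply/asboolP.
  exists c'; split=> // n wn nc r' lr'.
  by apply: win_inS (wc' nc _ lr'); exact: (min_m n.+1 (asboolT wn)).
pose sigma (h : seq G) := foldl (fun c r => step (c, r)) c0 h.
have sigmaS h r : sigma (rcons h r) = step (sigma h, r) by rewrite /sigma foldl_rcons.
exists sigma => [h r i|rho lrho].
  by rewrite sigmaS; have [] := stepP (sigma h, r).
suff main n k : win_in n (sigma (mkseq rho k)) (rho k) -> captures sigma rho.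
  by have [n] := win0 (rho 0); exact: main n 0.
elim: n k => // n IH k wk.
case: (pselect (captures sigma rho)) => // ncap.
have [_ /(_ n wk) wstep] := stepP (sigma (mkseq rho k), rho k).
apply: (IH k.+1); rewrite mkseqS sigmaS; apply: wstep => [i ci|]; last exact: lrho.
by apply: ncap; exists k, i; right; rewrite mkseqS sigmaS.
Qed.

(* A cop protects part of the boundary by keeping to the shadow [f r] of the
   robber's position [r].  [switch C f g]: a cop standing on its [f]-shadow can,
   after any robber move inside [C], step onto its [g]-shadow; in particular
   [switch C f f] says that the [f]-shadow can be followed. *)
Definition switch C f g : Prop :=
  forall r r', r \in C -> r' \in C -> legal_move r r' -> legal_move (f r) (g r').

(** The cop stands on the shadow of [r] when the robber steps from [r] to [q], and must be able to
    capture in reply. *)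
Definition covers C f (q : G) : Prop :=
  forall r, r \in C -> r -- q -> legal_move (f r) q.

(* A cop following [f] can pass to following [g] while covering [X] throughout. *)
Inductive leads C X : (G -> G) -> (G -> G) -> Prop :=
| leads_refl f : leads C X f f
| leads_step f f' g : (forall q, X q -> covers C f q) -> switch C f f' ->
    leads C X f' g -> leads C X f g.

(** A constant shadow means standing still: the cop protects [q] and can come to rest on it without
    unprotecting it, ready to start a new shadow there. *)
Definition keeps C f (q : G) : Prop := leads C (pred1 q) f (fun=> q).

Lemma switchS C D f g : D \subset C -> switch C f g -> switch D f g.
Proof. by move=> /subsetP sDC sw r r' /sDC rC /sDC r'C; exact: sw. Qed.

Lemma leadsS C D X f g : D \subset C -> leads C X f g -> leads D X f g.
Proof.
move=> sDC; elim=> {f g} [f|f f' g cov sw _ IH]; first exact: leads_refl.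
apply: leads_step (switchS sDC sw) IH => q /cov cq r rD.
by apply: cq; exact: (subsetP sDC).
Qed.

Lemma leads_weaken C X Y f g : (forall q, Y q -> X q) -> leads C X f g -> leads C Y f g.
Proof.
move=> sYX; elim=> {f g} [f|f f' g cov sw _ IH]; first exact: leads_refl.
by apply: leads_step sw IH => q /sYX/cov.
Qed.

Lemma leads_trans C X f g h : leads C X f g -> leads C X g h -> leads C X f h.
Proof. by elim=> // {}f f' {}g cov sw _ IH /IH; exact: leads_step. Qed.

Lemma leads_chain C X (h : nat -> G -> G) n :
  (forall i, i < n -> switch C (h i) (h i.+1)) ->
  (forall i q, i < n -> X q -> covers C (h i) q) -> leads C X (h 0) (h n).
Proof.
elim: n h => [|n IH] h sw cov; first exact: leads_refl.
apply: leads_step (sw 0 _) _ => // [q|]; first exact: cov.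
by apply: (IH (fun i => h i.+1)) => [i|i q] lt; [exact: sw | exact: cov].
Qed.

Lemma keeps_covers C f q : keeps C f q -> covers C f q.
Proof.
rewrite /keeps; move E: (fun=> q) => g k; case: k E => [_ <- r _ _|].
  by rewrite /legal_move eqxx.
by move=> f1 f' g1 cov _ _ _; apply: cov; rewrite /= eqxx.
Qed.

Lemma leads_const C f q a : connected_graph G -> keeps C f q -> leads C pred0 f (fun=> a).
Proof.
move=> connG kq; apply: leads_trans (leads_weaken _ kq) _ => //.
have /connectP[p] := connG q a; elim: p q {kq} => [|z p IH] q /=.
  by move=> _ ->; exact: leads_refl.
case/andP=> qz pz /(IH _ pz); apply: leads_step => // r r' _ _ _.
by rewrite /legal_move qz orbT.
Qed.

(** It is the cops' turn, and each of them can reach its shadow of [r] with this move. *)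
Definition winning C F : Prop :=
  forall c r, r \in C -> (forall i, legal_move (c i) (F i r)) -> wins c r.

Lemma legal_exits C r r' : r \in C -> r' \notin C -> legal_move r r' ->
  r -- r' /\ r' \in boundary C.
Proof.
move=> rC r'C /orP[/eqP E|rr']; first by rewrite -E rC in r'C.
by split; rewrite // inE r'C; apply/existsP; exists r; rewrite rC.
Qed.

(** The cops step onto their [F]-shadows. If the robber then leaves [C], he enters a covered
    boundary vertex and is captured; otherwise the cops are ready for [F']. *)
Lemma winning_switch C F F' :
  (forall v, v \in boundary C -> exists i, covers C (F i) v) ->
  (forall i, switch C (F i) (F' i)) -> winning C F' -> winning C F.
Proof.
move=> cov sw win c r rC ready.
apply: (@wins_step _ [ffun i => F i r]) => [i|r' lr']; first by rewrite ffunE.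
have [r'C|r'C] := boolP (r' \in C).
  by apply: win => // i; rewrite ffunE; exact: sw.
have [rr' /cov[i ci]] := legal_exits rC r'C lr'.
by apply: (@wins_capture _ _ i); rewrite ffunE; exact: ci.
Qed.

Definition upd (T : Type) (F : 'I_K -> T) j (f : T) : 'I_K -> T :=
  fun i => if i == j then f else F i.

Lemma updE (T : Type) (F : 'I_K -> T) j (f : T) : upd F j f j = f.
Proof. by rewrite /upd eqxx. Qed.

Lemma updN (T : Type) (F : 'I_K -> T) j (f : T) i : i != j -> upd F j f i = F i.
Proof. by rewrite /upd => /negbTE->. Qed.

(** Cop [j] changes its shadow while the others keep following theirs; at each stage it covers [X],
    and they cover the rest of the boundary. *)
Lemma winning_leads C F j f X :
  (forall i, switch C (F i) (F i)) ->
  (forall v, v \in boundary C -> X v \/ exists2 i, i != j & covers C (F i) v) ->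
  leads C X (F j) f -> winning C (upd F j f) -> winning C F.
Proof.
move=> valid cov ld.
have -> : winning C F = winning C (upd F j (F j)).
  by congr winning; apply/funext => i; rewrite /upd; case: eqP => // ->.
elim: ld => // g g' h covg sw _ IH /IH.
apply: winning_switch => [v /cov[Xv|[i nij ci]]|i].
- by exists j; rewrite updE; exact: covg.
- by exists i; rewrite updN.
- by rewrite /upd; case: eqP.
Qed.

(** A robber on [S] is captured at once by the cop whose shadow fixes his position. Otherwise he is
    in a component [D] of [C :\: S], whose boundary is contained in that of [C] together with
    [S]. *)
Lemma winning_split C F (S : {set G}) :
  (forall v, v \in S -> exists i, F i v = v) ->
  (forall D, D != set0 -> D \subset C :\: S -> conn D ->
     (forall v, v \in boundary D -> v \in boundary C \/ v \in S) -> winning D F) ->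
  winning C F.
Proof.
move=> fixS winD c r rC ready.
have [/fixS[i fi]|rS] := boolP (r \in S).
  by apply: (@wins_capture _ _ i); have := ready i; rewrite fi.
pose D := [set x | connect (inside (C :\: S)) r x].
have rD : r \in D by rewrite inE connect0.
have stepD x y : x \in D -> inside (C :\: S) x y -> y \in D.
  by rewrite !inE => rx xy; exact: connect_trans rx (connect1 xy).
have sD : D \subset C :\: S.
  apply/subsetP => x; rewrite !inE => /connectP[p + ->].
  elim/last_ind: p => [|p y _]; first by rewrite /= rC rS.
  by rewrite rcons_path last_rcons => /andP[_ /and3P[_ _]]; rewrite !inE.
apply: (winD D) => //; first by apply/set0Pn; exists r.
  have rto x : x \in D -> connect (inside D) r x.
    rewrite inE => /connectP[p + ->]; elim/last_ind: p => // p y IH.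
    rewrite rcons_path last_rcons => /andP[pp py]; apply: connect_trans (IH pp) _.
    have lD : last r p \in D by rewrite inE; apply/connectP; exists p.
    apply: connect1; rewrite /inside /= lD (stepD _ _ lD py) !andbT.
    by case/and3P: py.
  move=> x y /rto rx /rto ry; apply: connect_trans ry.
  by rewrite inside_sym.
move=> v; rewrite inE => /andP[vD /existsP[u /andP[uD uv]]].
have /setDP[uC uS] := subsetP sD _ uD.
have [vS|vS] := boolP (v \in S); first by right.
left; rewrite inE; apply/andP; split; last by apply/existsP; exists u; rewrite uC.
apply: contra vD => vC; apply: stepD uD _.
by rewrite /inside /= uv !inE uC uS vC vS.
Qed.

End Game.

(** * Guarding a geodesic through the territory *)

Section Geodesic.
Variables (G : sgraph) (C : {set G}) (a b : G).
Hypotheses (connC : conn C) (aC : a \in boundary C) (bC : b \in boundary C).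
Hypothesis nab : a != b.

(* The edge [a -- b], if there is one, is excluded, so that the shortest path
   from [a] to [b] enters [C]; the robber cannot use that edge anyway. *)
Let e (x y : G) : bool :=
  (x -- y) && ((x \in C) && (y \in a |: (b |: C)) || (y \in C) && (x \in a |: (b |: C))).

Let ball n : {set G} := iter n (fun B => B :|: [set y | [exists x in B, e x y]]) [set a].

Let ballS n x y : x \in ball n -> e x y -> y \in ball n.+1.
Proof.
move=> xn xy; rewrite !inE; apply/orP; right; apply/existsP.
by exists x; rewrite xn.
Qed.


Let aNC : a \notin C. Proof. by move: aC; rewrite inE => /andP[]. Qed.
Let bNC : b \notin C. Proof. by move: bC; rewrite inE => /andP[]. Qed.

Let reach x : x \in a |: (b |: C) -> exists n, x \in ball n.
Proof.
have step x' y : (exists n, x' \in ball n) -> e x' y -> exists n, y \in ball n.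
  by move=> [n xn] /(ballS xn); exists n.+1.
have ra : exists n, a \in ball n by exists 0; rewrite inE.
have rC u : u \in C -> exists n, u \in ball n.
  move: aC; rewrite inE => /andP[_ /existsP[u0 /andP[u0C u0a]]] uC.
  have ru0 : exists n, u0 \in ball n.
    by apply: step ra _; rewrite /e edge_sym u0a u0C !inE eqxx orbT.
  have /connectP[p + ->] := connC u0C uC.
  elim: p u0 ru0 {u0C u0a} => //= z p IH u0 ru0 /andP[/and3P[uz u0C zC]].
  by apply: IH; apply: step ru0 _; rewrite /e uz u0C !inE zC !orbT.
rewrite !inE => /or3P[/eqP->//|/eqP->|]; last exact: rC.
move: bC; rewrite inE => /andP[_ /existsP[u /andP[uC ub]]].
by apply: step (rC _ uC) _; rewrite /e ub uC !inE eqxx orbT.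
Qed.

(** The distance from [a] along [e]; the value 0 at unreachable vertices is a mere default. *)
Let d x : nat := if pselect (exists n, x \in ball n) is left h then ex_minn h else 0.

Let dP x : x \in a |: (b |: C) -> x \in ball (d x) /\ forall n, x \in ball n -> d x <= n.
Proof. by move=> /reach r; rewrite /d; case: pselect => // h; case: ex_minnP. Qed.

Let d_step x y : e x y -> d y <= (d x).+1.
Proof.
move=> xy; have [xE yE] : x \in a |: (b |: C) /\ y \in a |: (b |: C).
  by case/andP: xy => _ /orP[] /andP[]; rewrite !inE => -> ->; rewrite !orbT.
have [xd _] := dP xE; have [_] := dP yE; apply; exact: ballS xd xy.
Qed.

Let d_a : d a = 0.
Proof.
by have [_ /(_ 0)] := dP (setU11 a _); rewrite inE eqxx; case: (d a) => // n /(_ isT).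
Qed.

Let d_pred y n : y \in a |: (b |: C) -> d y = n.+1 -> exists2 x, e x y & d x = n.
Proof.
move=> yE dy; have [] := dP yE; rewrite dy inE => /orP[yn /(_ _ yn)|]; first by rewrite ltnn.
rewrite inE => /existsP[x /andP[xn xy]] _; exists x => //.
have xE : x \in a |: (b |: C).
  by case/andP: xy => _ /orP[] /andP[]; rewrite !inE => // ->; rewrite !orbT.
have [_ /(_ _ xn)] := dP xE; have := d_step xy; rewrite dy; lia.
Qed.

Let chain n y : y \in a |: (b |: C) -> d y = n ->
  exists p : nat -> G, [/\ p 0 = a, p n = y, forall i, i <= n -> d (p i) = i &
    forall i, i < n -> e (p i) (p i.+1)].
Proof.
elim: n y => [|n IH] y yE dy.
  have [+ _] := dP yE; rewrite dy inE => /eqP ya; exists (fun=> a); split=> // i.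
  by rewrite leqn0 d_a => /eqP.
have [x xy dx] := d_pred yE dy.
have xE : x \in a |: (b |: C).
  by case/andP: xy => _ /orP[] /andP[]; rewrite !inE => // ->; rewrite !orbT.
have [p [p0 pn dp ep]] := IH x xE dx.
exists (fun i => if i <= n then p i else y); split=> // [|i|i]; rewrite ?ltnn //.
- by rewrite leq_eqVlt => /predU1P[->|lin]; rewrite ?ltnn // -ltnS lin dp.
- rewrite ltnS => lin; rewrite lin; case: ltnP => [/ep //|nin].
  by have -> : i = n by [lia]; rewrite pn.
Qed.

(** Take a shortest [e]-path from [a] to [b]. The shadow of [r] is its vertex at distance [d r] from
    [a], or [b] if [r] is farther away. A robber move inside [C] changes [d] by at most one, so the
    shadow can be followed, and it fixes the path. *)
Lemma geodesic : exists s f,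
  [/\ path edge a (rcons s b), uniq s, s != [::], {subset s <= C} &
   [/\ switch C f f, forall v, v \in s -> f v = v, leads C (pred1 a) (fun=> a) f &
    forall v, v \in a :: b :: s -> keeps C f v]].
Proof.
have bE : b \in a |: (b |: C) by rewrite !inE eqxx orbT.
have [p [p0 pl dp ep]] := chain bE erefl; set l := d b in pl dp ep.
have l_gt1 : 1 < l.
  rewrite ltnNge; apply/negP => l1; case: (posnP l) => [l0|l_gt0].
    by move: nab; rewrite -pl l0 p0 eqxx.
  have := ep 0 l_gt0; have -> : 1 = l by lia.
  by rewrite p0 pl /e (negbTE aNC) (negbTE bNC) /= andbF.
have p_legal i j : i <= l -> j <= l -> i <= j.+1 -> j <= i.+1 -> legal_move (p i) (p j).
  have up k : k < l -> legal_move (p k) (p k.+1).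
    by move=> /ep/andP[kk _]; rewrite /legal_move kk orbT.
  move=> il jl ij ji; case: (ltngtP i j) => [lt|gt|->]; last by rewrite /legal_move eqxx.
    by have -> : j = i.+1 by [lia]; apply: up; lia.
  by have -> : i = j.+1 by [lia]; rewrite legal_sym; apply: up; lia.
(* Shadows with a truncated index: widening the window [[0, k]] starts from the
   constant [a], narrowing the window around [i] ends at the constant [p i]. *)
pose h lo hi x := p (maxn lo (minn hi (d x))).
have d_legal r r' : r \in C -> r' \in a |: (b |: C) -> legal_move r r' ->
    d r <= (d r').+1 /\ d r' <= (d r).+1.
  move=> rC r'E /orP[/eqP->//|rr']; split; apply: d_step; last by rewrite /e rr' rC r'E.
  by rewrite /e edge_sym rr' rC r'E orbT.
have CE x : x \in C -> x \in a |: (b |: C) by rewrite !inE => ->; rewrite !orbT.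
have sw lo hi lo' hi' : lo <= hi <= l -> lo' <= hi' <= l ->
    lo <= lo'.+1 -> lo' <= lo.+1 -> hi <= hi'.+1 -> hi' <= hi.+1 ->
    switch C (h lo hi) (h lo' hi').
  by move=> *; move=> r r' rC /CE r'E /(d_legal _ _ rC r'E)[? ?]; apply: p_legal; lia.
have cov lo hi i : p i \in a |: (b |: C) -> lo <= i <= hi -> hi <= l ->
    covers C (h lo hi) (p i).
  move=> piE lh hl r rC rp.
  have [] := d_legal r (p i) rC piE; first by rewrite /legal_move rp orbT.
  by rewrite dp; last lia; move=> *; apply: p_legal; lia.
have piC i : 0 < i < l -> p i \in C.
  case/andP=> i0 il; have pa : p i != a.
    by apply/eqP => /(congr1 d); rewrite dp ?d_a; lia.
  have pb : p i != b by apply/eqP => /(congr1 d); rewrite dp; lia.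
  by have := ep _ il; rewrite /e !inE (negbTE pa) (negbTE pb) /= => /andP[_ /orP[] /andP[]].
have piE i : i <= l -> p i \in a |: (b |: C).
  move=> il; case: (posnP i) => [->|i0]; first by rewrite p0 setU11.
  case: (ltngtP i l) => [lt||->]; [by apply/CE/piC; lia | lia | by rewrite pl].
pose s := mkseq (fun i => p i.+1) l.-1.
have sP v : v \in s -> exists2 i, 0 < i < l & v = p i.
  by move=> /mapP[i]; rewrite mem_iota => il ->; exists i.+1; first lia.
exists s, (h 0 l); split.
- have -> : b = p l.-1.+1 by rewrite prednK // (ltnW l_gt1).
  rewrite -(mkseqS (fun i => p i.+1)) prednK ?(ltnW l_gt1) // -p0.
  apply/(pathP a) => i; rewrite size_mkseq => il; rewrite nth_mkseq //.
  have := ep _ il; case/andP => + _; case: i il => //= i il.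
  by rewrite nth_mkseq //; lia.
- rewrite map_inj_in_uniq ?iota_uniq // => i j; rewrite !mem_iota => il jl.
  by move/(congr1 d); rewrite !dp; lia.
- by rewrite -size_eq0 size_mkseq; lia.
- by move=> v /sP[i il ->]; exact: piC.
split.
- by apply: sw; lia.
- move=> v /sP[i il ->]; rewrite /h dp; last lia.
  by congr p; lia.
- have -> : (fun=> a) = h 0 0 by apply/funext => x; rewrite /h min0n maxnn p0.
  apply: (@leads_chain G C (pred1 a) (fun k => h 0 k) l) => [i il|i q il /eqP->].
    by apply: sw; lia.
  by rewrite -p0; apply: cov; [exact: piE | lia | lia].
move=> v vs; have [i il ->] : exists2 i, i <= l & v = p i.
  move: vs; rewrite !inE => /or3P[/eqP->|/eqP->|/sP[i il ->]].
  - by exists 0; rewrite ?p0.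
  - by exists l; rewrite ?pl.
  - by exists i; first lia.
(* The window of radius [l - k] around [i], cut off at [l] and, by truncated subtraction, at 0: it
   is everything for [k = 0] and only [i] for [k = l]. *)
pose w k := h (i - (l - k)) (minn l (i + (l - k))).
have -> : h 0 l = w 0 by rewrite /w /h; apply/funext => x; congr p; lia.
have wl : (fun=> p i) = w l.
  by apply/funext => x; rewrite /w /h; congr p; lia.
rewrite /keeps wl; apply: leads_chain => [k kl|k q kl /eqP->].
  by apply: sw; lia.
by apply: cov; [exact: piE | lia | lia].
Qed.

End Geodesic.
(** * Shrinking the territory *)

Section Chase.
Variables (G : sgraph) (K t : nat).
Hypotheses (connG : connected_graph G) (tK : t <= (2 * K).-1).
Hypothesis freeG : minor_free (complete_bipartite 2 t) G.
Implicit Types (C D A : {set G}) (F : 'I_K -> G -> G) (s : 'I_K -> seq G).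
Implicit Types (f : G -> G) (p : seq G) (x : G) (j : 'I_K) (Q : {set 'I_K}).

Lemma boundaryS C D v : D \subset C -> v \in boundary D -> v \notin C -> v \in boundary C.
Proof.
move=> /subsetP sDC; rewrite !inE => /andP[_ /existsP[u /andP[uD uv]]] ->.
by apply/existsP; exists u; rewrite sDC.
Qed.

(** If cop [j] keeps [a], it retreats to [a] and takes up the geodesic from there, covering [a]
    throughout. If not, the other cops cover the whole boundary and it may walk to [a] freely. The
    guarded path then cuts down the territory. *)
Lemma recruit C F j a b :
  conn C -> a \in boundary C -> b \in boundary C -> a != b ->
  (forall i, switch C (F i) (F i)) -> (exists q, keeps C (F j) q) ->
  (forall v, v \in boundary C ->
     (exists2 i, i != j & covers C (F i) v) \/ v = a /\ keeps C (F j) a) ->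
  (forall p f D, path edge a (rcons p b) -> uniq p -> {subset p <= C} ->
     switch C f f -> (forall v, v \in a :: b :: p -> keeps C f v) ->
     D != set0 -> D \proper C -> {in p, forall v, v \notin D} -> conn D ->
     (forall v, v \in boundary D -> v \in boundary C \/ v \in p) ->
     winning D (upd F j f)) ->
  winning C F.
Proof.
move=> cC aC bC nab valid [q kq] cov win.
have [p [f [pp up p0 pC [vf fixf lf kf]]]] := geodesic cC aC bC nab.
have winf : winning C (upd F j f).
  apply: (@winning_split _ _ _ _ [set v in p]) => [v|D D0 sD cD bD].
    by rewrite inE => vp; exists j; rewrite updE fixf.
  apply: (win p f D) => //.
  - apply/properP; split; first exact: subset_trans sD (subsetDl _ _).
    case: p p0 pC {pp up fixf kf bD} sD => // v p _ pC sD.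
    exists v; first by apply: pC; exact: mem_head.
    by apply/negP => /(subsetP sD); rewrite !inE eqxx.
  - by move=> v vp; apply/negP => /(subsetP sD); rewrite !inE vp.
  - by move=> v /bD; rewrite inE.
case: (pselect (keeps C (F j) a)) => [ka|nka].
  apply: winning_leads valid _ (leads_trans ka lf) winf => v /cov[|[-> _]]; first by right.
  by left; rewrite /= eqxx.
apply: (winning_leads (X := pred0)) winf => //; last first.
  by apply: leads_trans (leads_const _ connG kq) (leads_weaken _ lf).
by move=> v /cov[|[_ /nka]//]; right.
Qed.

(** Cop [j] is responsible for the boundary vertices on its own path ([sys_keep]). By [sys_free] it
    can always come to rest somewhere, from where it may walk anywhere once it has no duties. *)
Record system C F A s : Prop := System {
  sysC0 : C != set0;
  sysC : conn C;
  sysA : conn A;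
  sysCA : [disjoint C & A];
  sys_uniq : forall j, uniq (s j);
  sys_out : forall j v, v \in s j -> v \notin C :|: A;
  sys_dis : forall i j v, v \in s i -> v \in s j -> i = j;
  sys_valid : forall j, switch C (F j) (F j);
  sys_free : forall j, exists q, keeps C (F j) q;
  sys_keep : forall j v, v \in s j -> v \in boundary C -> keeps C (F j) v }.

Lemma system_upd C F A s D j f p :
  system C F A s -> D != set0 -> conn D -> D \subset C -> switch C f f ->
  (exists q, keeps C f q) -> uniq p ->
  (forall v, v \in p -> v \in s j \/ v \in C :\: D) ->
  (forall v, v \in p -> v \in boundary D -> keeps C f v) ->
  system D (upd F j f) A (upd s j p).
Proof.
case=> C0 cC cA dCA us os ds vF fF ks D0 cD sDC vf [q kq] up ps kp.
have CA v : v \in C -> v \notin A by move=> vC; rewrite (disjointFr dCA vC).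
have pj i v : i != j -> v \in p -> v \in s i -> False.
  move=> nij /ps[vj vi|/setDP[vC _] /os]; first by rewrite (ds _ _ _ vi vj) eqxx in nij.
  by rewrite inE vC.
split=> //.
- by apply: disjointWl dCA.
- by move=> i; rewrite /upd; case: ifP.
- move=> i v; rewrite /upd !inE; case: ifP => _.
    case/ps=> [/os|/setDP[vC vD]]; last by rewrite (negbTE vD) CA.
    by rewrite inE !negb_or => /andP[vC ->]; rewrite andbT (contra (subsetP sDC v)).
  by move/os; rewrite inE !negb_or => /andP[vC ->]; rewrite andbT (contra (subsetP sDC v)).
- move=> i i' v; rewrite /upd; case: eqVneq => [->|ni]; case: eqVneq => [->|ni'] //.
  + by move=> vp /(pj _ _ ni' vp).
  + by move=> vi /(pj _ _ ni)/(_ vi).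
  + exact: ds.
- by move=> i; rewrite /upd; case: ifP => _; apply: (switchS sDC).
- move=> i; rewrite /upd; case: ifP => _; last have [q' kq'] := fF i.
    by exists q; exact: leadsS kq.
  by exists q'; exact: leadsS kq'.
- move=> i v; rewrite /upd; case: ifP => _ vs vD; apply: (leadsS sDC); first exact: kp.
  apply: ks => //; apply: boundaryS sDC vD _.
  by have := os _ _ vs; rewrite inE negb_or => /andP[].
Qed.

Lemma system_sub C F A s s' :
  system C F A s -> (forall j, uniq (s' j)) -> (forall j, {subset s' j <= s j}) ->
  system C F A s'.
Proof.
case=> C0 cC cA dCA us os ds vF fF ks us' ss'; split=> //.
- by move=> j v /ss'; exact: os.
- by move=> i j v /ss' vi /ss'; exact: ds.
- by move=> j v /ss'; exact: ks.
Qed.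

(** The center absorbs the initial part of a path, staying connected because that part is a tail. *)
Lemma system_grow C F A s j p p' :
  system C F A s -> s j = p ++ p' -> tail A p ->
  system C F (A :|: [set v in p]) (upd s j p').
Proof.
move=> S; have [C0 cC cA dCA us os ds vF fF ks] := S => sj tp.
have up := us j; rewrite sj cat_uniq in up; case/and3P: up => up /hasPn npp' up'.
have [] : system C F A (upd s j p').
  apply: (system_sub S) => i; rewrite /upd; case: eqVneq => // [-> v|_ v //].
  by rewrite sj mem_cat => ->; rewrite orbT.
move=> _ _ _ _ us' os' ds' _ _ ks'; split=> //.
- exact: conn_tail.
- apply/pred0P => v; apply/negbTE; rewrite /= !inE; apply/negP => /andP[vC].
  rewrite (disjointFr dCA vC) /= => vp.
  by have := os j v; rewrite sj mem_cat vp inE vC => /(_ isT).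
- move=> i v vi; have := os' _ _ vi; rewrite !inE !negb_or => /andP[-> ->] /=.
  move: vi; rewrite /upd; case: eqVneq => [_ /npp' //|nij vi].
  apply/negP => vp; have := ds i j v vi; rewrite sj mem_cat vp => /(_ isT) E.
  by rewrite E eqxx in nij.
Qed.

(* Only [x] among the vertices of the center can be on the boundary. *)
Record star C F A x j0 s : Prop := Star {
  star_sys : system C F A s;
  star_x : x \in A;
  star_tail : tail A (s j0);
  star_ear : forall j, j != j0 -> s j = [::] \/ ear A (s j);
  star_keep : x \in boundary C -> keeps C (F j0) x;
  star_cover : forall v, v \in boundary C -> v = x \/ exists j, v \in s j }.

(* The center [x2 |: A] may have two boundary vertices [x1] and [x2], both
   protected by every cop in [Q].  The path of a cop in [Q] leads from [x2] back
   to [A], so it becomes an ear of the center as soon as [x1] or [x2] leaves the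
   boundary. *)
Record fork C F A x1 x2 j0 Q s : Prop := Fork {
  fork_sys : system C F (x2 |: A) s;
  fork_A : conn A;
  fork_x1 : x1 \in A;
  fork_x2 : x2 \notin A;
  fork_j0 : j0 \in Q;
  fork_tail : path edge x2 (s j0);
  fork_Q : forall j, j \in Q -> j != j0 ->
    exists2 a, a \in A & path edge x2 (rcons (s j) a);
  fork_ear : forall j, j \notin Q -> s j = [::] \/ ear A (s j);
  fork_keep : forall j, j \in Q -> keeps C (F j) x1 /\ keeps C (F j) x2;
  fork_cover : forall v, v \in boundary C -> [\/ v = x1, v = x2 | exists j, v \in s j] }.

(** * The induction step for one territory *)

Section Step.
Variable C : {set G}.
Hypothesis IHstar : forall D F A x j0 s, D \proper C -> star D F A x j0 s -> winning D F.
Hypothesis IHfork : forall D F A x1 x2 j0 Q s,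
  D \proper C -> fork D F A x1 x2 j0 Q s -> winning D F.

(** Cop [j0] has at most [x] to protect. It goes to [x] and on to a neighbour [u] in [C], from where
    it still covers [x]. The territory loses [u], which becomes the path of [j0]. *)
Lemma winning_star_bare F A x j0 s :
  star C F A x j0 s -> x \in boundary C -> ~~ has [in boundary C] (s j0) -> winning C F.
Proof.
case=> S xA tj0 es kx cov xC nj0; move: (kx xC) => {}kx.
have [C0 cC cA dCA us os ds vF fF ks] := S.
move: (xC); rewrite inE => /andP[_ /existsP[u /andP[uC ux]]].
have lxu : legal_move x u by rewrite /legal_move edge_sym ux orbT.
have ku : keeps C (fun=> u) x.
  apply: leads_step (leads_refl _ _ _) => [q /eqP-> r _ _|r r' _ _ _] //.
    by rewrite legal_sym.
  by rewrite legal_sym.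
apply: (@winning_leads _ _ _ _ j0 (fun=> u) (pred1 x)) => //.
- move=> v vC; case: (eqVneq v x) => [->|nvx]; first by left; rewrite /= eqxx.
  right; have [E|[j vj]] := cov _ vC; first by rewrite E eqxx in nvx.
  exists j; last by apply: keeps_covers; exact: ks vj vC.
  by apply: contra nj0 => /eqP<-; apply/hasP; exists v.
- apply: leads_trans kx _; apply: leads_step (leads_refl _ _ _) => [q /eqP->|] r //.
  by move=> _ _; rewrite /legal_move eqxx.
apply: (@winning_split _ _ _ _ [set u]) => [v /set1P->|D D0 sD cD bD].
  by exists j0; rewrite updE.
have sDC : D \subset C by apply: subset_trans sD _; exact: subsetDl.
have uD : u \notin D by apply/negP => /(subsetP sD); rewrite !inE eqxx.
apply: (IHstar (A := A) (x := x) (j0 := j0) (s := upd s j0 [:: u])).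
  by apply/properP; split=> //; exists u.
have uu : keeps C (fun=> u) u by exact: leads_refl.
split=> //.
- apply: (system_upd S) => // [r r' _ _ _||v|v]; rewrite ?inE.
  + by rewrite /legal_move eqxx.
  + by exists u.
  + by move=> /eqP->; right; rewrite uD.
  + by move=> /eqP->.
- by rewrite updE; exists x; rewrite //= edge_sym ux.
- by move=> j nj; rewrite updN //; exact: es.
- by move=> _; rewrite updE; exact: leadsS sDC ku.
- move=> v /bD[vC|/set1P->]; last by right; exists j0; rewrite updE mem_head.
  have [->|[j vj]] := cov _ vC; [by left | right; exists j; rewrite updN //].
  by apply: contra nj0 => /eqP<-; apply/hasP; exists v.
Qed.

(** Cop [i] protects [x1] and [x2], so cop [j] has no duties. It takes a geodesic from [x2] to [x1],
    whose interior becomes its path, and joins [Q]; such a path also suits [j = j0]. *)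
Lemma fork_recruit_free F A x1 x2 j0 Q s i j :
  fork C F A x1 x2 j0 Q s -> x1 \in boundary C -> x2 \in boundary C ->
  i \in Q -> i != j -> ~~ has [in boundary C] (s j) -> winning C F.
Proof.
case=> S cA x1A x2A j0Q tj0 eQ es kQ cov x1C x2C iQ nij nj.
have [C0 cC cA2 dCA us os ds vF fF ks] := S.
have nx : x2 != x1 by apply: contra x2A => /eqP->.
have nsj v : v \in boundary C -> v \notin s j.
  by move=> vC; apply: contra nj => vs; apply/hasP; exists v.
have covC v : v \in boundary C -> exists2 i', i' != j & keeps C (F i') v.
  have [k1 k2] := kQ _ iQ.
  move=> vC; have [->|->|[j' vj']] := cov _ vC; [by exists i | by exists i |].
  by exists j'; [apply: contra (nsj _ vC) => /eqP<- | exact: ks].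
apply: (@recruit _ _ j x2 x1) => // [v /covC[i' ni' ki']|].
  by left; exists i' => //; exact: keeps_covers.
move=> p f D pp up pC vf kf D0 pD pND cD bD.
have sDC := proper_sub pD.
have kp v : v \in p -> keeps C f v by move=> vp; apply: kf; rewrite !inE vp !orbT.
have kx2 : keeps C f x2 by apply: kf; rewrite mem_head.
have kx1 : keeps C f x1 by apply: kf; rewrite !inE eqxx orbT.
apply: (IHfork (A := A) (x1 := x1) (x2 := x2) (j0 := j0) (Q := j |: Q) (s := upd s j p)) => //.
split=> //.
- apply: (system_upd S) => // [||v vp]; first by exists x1.
    by move=> v vp; right; rewrite inE pND ?pC.
  by move=> _; exact: kp.
- by rewrite setU1r.
- by rewrite /upd; case: eqP => // _; move: pp; rewrite rcons_path => /andP[].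
- move=> j'; rewrite !inE /upd; case: eqVneq => [_ _ _|nj' j'Q nj'0]; first by exists x1.
  exact: eQ.
- by move=> j'; rewrite !inE negb_or => /andP[nj' j'Q]; rewrite updN //; exact: es.
- move=> j'; rewrite !inE /upd; case: eqVneq => [_ _|_ /kQ[k1 k2]].
    by split; exact: leadsS sDC _.
  by split; exact: leadsS sDC _.
- move=> v /bD[vC|vp]; last by constructor 3; exists j; rewrite updE.
  have [->|->|[j' vj']] := cov _ vC; [by constructor 1 | by constructor 2 | constructor 3].
  by exists j'; rewrite updN //; apply: contra (nsj _ vC) => /eqP<-.
Qed.

(** Cop [j] goes to the only boundary vertex [q] of its path and takes a geodesic from [q] to [x1].
    A piece of the old path from [A] to [q], followed by the geodesic, is an ear of [A], so [j] is
    not in the new [Q]; [x1] and [x2] are left to [j0]. *)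
Lemma fork_recruit_single F A x1 x2 j0 Q s j :
  fork C F A x1 x2 j0 Q s -> x1 \in boundary C -> x2 \in boundary C ->
  j != j0 -> count [in boundary C] (s j) = 1 -> winning C F.
Proof.
case=> S cA x1A x2A j0Q tj0 eQ es kQ cov x1C x2C nj0 cj.
have [C0 cC cA2 dCA us os ds vF fF ks] := S.
have [q [qs qC uq]] : exists q, [/\ q \in s j, q \in boundary C &
    forall v, v \in s j -> v \in boundary C -> v = q].
  move: cj; rewrite -size_filter; case E: [seq _ <- _ | _] => [|q [|]] // _.
  have inE' v : (v \in boundary C) && (v \in s j) = (v == q).
    by have := mem_filter [in boundary C] v (s j); rewrite E inE => ->.
  have /andP[qC qs] : (q \in boundary C) && (q \in s j) by rewrite inE'.
  by exists q; split=> // v vs vC; apply/eqP; rewrite -inE' vC vs.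
(* For [j] in [Q] this is the end of the path away from [x2], read backwards; for other [j] it is
   the beginning of the ear. *)
have [p0 [tp0 up0 sp0]] : exists p0, [/\ tail A (rcons p0 q), uniq (rcons p0 q) &
    {subset rcons p0 q <= s j}].
  have := us j; have [jQ|jQ] := boolP (j \in Q).
    have [a aA] := eQ _ jQ nj0; case/splitPr: qs => p1 p2 pp up.
    exists (rev p2); rewrite -rev_cons; split.
    - move/path_edge_rev: pp; rewrite rev_cat rcons_cat cat_path => /andP[pp _].
      by exists a.
    - by move: up; rewrite cat_uniq rev_uniq => /and3P[].
    - by move=> v; rewrite mem_rev mem_cat => ->; rewrite orbT.
  case: (es _ jQ) => [E|]; first by rewrite E in qs.
  case/splitPr: qs => p1 p2 ep up; rewrite -cat_rcons in ep up *.
  exists p1; split; first exact: ear_tail ep.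
    by move: up; rewrite cat_uniq => /and3P[].
  by move=> v; rewrite mem_cat => ->.
have nqx : q != x1.
  by apply/eqP => E; have := os _ _ qs; rewrite E !inE x1A !orbT.
have kq := ks _ _ qs qC.
apply: (@recruit _ _ j q x1) => // [v vC|].
  have [k1 k2] := kQ _ j0Q.
  have [->|->|[j' vj']] := cov _ vC.
  - by left; exists j0; [rewrite eq_sym | exact: keeps_covers].
  - by left; exists j0; [rewrite eq_sym | exact: keeps_covers].
  have [E|nj'] := eqVneq j' j; first by right; split=> //; apply: uq; rewrite -?E.
  by left; exists j' => //; apply: keeps_covers; exact: ks vj' vC.
move=> p f D pp up pC vf kf D0 pD pND cD bD.
have sDC := proper_sub pD.
have kp v : v \in p -> keeps C f v by move=> vp; apply: kf; rewrite !inE vp !orbT.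
have kfq : keeps C f q by apply: kf; rewrite mem_head.
have sjC v : v \in s j -> v \notin C.
  by move=> /os; rewrite inE negb_or => /andP[].
apply: (IHfork (A := A) (x1 := x1) (x2 := x2) (j0 := j0) (Q := Q :\ j)
  (s := upd s j (rcons p0 q ++ p))) => //.
split=> //.
- apply: (system_upd S) => //.
  + by exists q.
  + rewrite cat_uniq up0 up andbT; apply/hasPn => v /pC vC.
    by apply: contraL vC => /sp0/sjC.
  + move=> v; rewrite mem_cat => /orP[/sp0|vp]; first by left.
    by right; rewrite inE pND ?pC.
  + move=> v; rewrite mem_cat => /orP[/sp0 vs vD|vp _]; last exact: kp.
    by rewrite (uq v vs) //; exact: boundaryS sDC vD (sjC _ vs).
- by rewrite !inE eq_sym nj0.
- by rewrite updN // eq_sym.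
- by move=> j'; rewrite inE => /andP[]; rewrite inE => nj' j'Q; rewrite updN //; exact: eQ.
- move=> j'; rewrite !inE negb_and negbK /upd; case: eqVneq => [_ _|nj' /=]; last exact: es.
  right; have [a aA pa] := tp0; exists a, x1; split=> //.
  by rewrite rcons_cat cat_path pa last_rcons.
- by move=> j'; rewrite !inE /upd => /andP[/negbTE-> /kQ[k1 k2]]; split; exact: leadsS sDC _.
- move=> v /bD[vC|vp]; last first.
    by constructor 3; exists j; rewrite updE mem_cat vp orbT.
  have [->|->|[j' vj']] := cov _ vC; [by constructor 1 | by constructor 2 | constructor 3].
  have [E|nj'] := eqVneq j' j; last by exists j'; rewrite updN.
  by exists j; rewrite updE (uq v) -?E // mem_cat mem_rcons mem_head.
Qed.

Lemma winning_fork_core F A x1 x2 j0 Q s :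
  fork C F A x1 x2 j0 Q s -> x1 \in boundary C -> x2 \in boundary C -> winning C F.
Proof.
move=> fk x1C x2C.
have [S cA x1A x2A j0Q tj0 eQ es kQ cov] := fk.
have [C0 cC cA2 dCA us os ds vF fF ks] := S.
case: (pselect (exists2 j, j != j0 & count [in boundary C] (s j) <= 1)) => [[j nj]|all2].
  rewrite leq_eqVlt => /predU1P[c1|]; first exact: fork_recruit_single fk x1C x2C nj c1.
  rewrite ltnS leqn0 -leqn0 leqNgt -has_count => c0.
  by apply: fork_recruit_free fk x1C x2C j0Q _ c0; rewrite eq_sym.
have {}all2 j : j != j0 -> 1 < count [in boundary C] (s j).
  by move=> nj; rewrite ltnNge; apply/negP => c1; apply: all2; exists j.
have [[j1 j1Q nj1]|Q1] := pselect (exists2 j1, j1 \in Q & j1 != j0).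
  have [hj0|nhj0] := boolP (has [in boundary C] (s j0)); last first.
    exact: fork_recruit_free fk x1C x2C j1Q nj1 nhj0.
  (* With [x2] in the center the paths of [Q] other than [s j0] are ears, and [s j0] is a tail that
     meets the boundary. *)
  case: freeG; apply: (@ears_minor _ K t C (x2 |: A) s j0) => //.
  - by apply/set0Pn; exists x2; exact: setU11.
  - by exists x2; first exact: setU11.
  move=> j nj; split; last exact: all2.
  have [jQ|/es[E|]] := boolP (j \in Q).
  - by have [a aA pa] := eQ _ jQ nj; exists x2, a; rewrite !inE eqxx aA orbT.
  - by have := all2 _ nj; rewrite E.
  - by apply: earS; exact: subsetUr.
have eA j : j != j0 -> ear A (s j).
  move=> nj; case: (es j) => [|E|//]; first by apply/negP => jQ; apply: Q1; exists j.
  by have := all2 _ nj; rewrite E.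
have [a aA ax2] : exists2 a, a \in A & a -- x2.
  have /connectP[[|z p] /=] := sysA S (setU11 x2 A) (setU1r x2 x1A).
    by move=> _ E; move: x2A; rewrite -E x1A.
  case/andP=> /and3P[x2z _]; rewrite !inE => /predU1P[E|zA] _ _.
    by rewrite E edge_irr in x2z.
  by exists z; rewrite // edge_sym.
have x2out j v : v \in s j -> v != x2.
  by move=> /os; rewrite !inE !negb_or => /and3P[].
(* Only [j0] is in [Q], so the other paths are ears of [A] alone. Hence [x2] can be moved from the
   center to the front of [s j0], which gives that path a boundary vertex. *)
case: freeG; apply: (@ears_minor _ K t C A (upd s j0 (x2 :: s j0)) j0) => //.
- by apply/set0Pn; exists x1.
- by apply: disjointWr dCA; exact: subsetUr.
- move=> j; rewrite /upd; case: eqP => // _ /=; rewrite us andbT.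
  by apply/negP => /x2out/eqP.
- move=> j v; have outA i : v \in s i -> v \notin C :|: A.
    by move=> /os; rewrite !inE !negb_or => /and3P[-> _ ->].
  rewrite /upd; case: eqP => [_|_ /outA //]; rewrite inE => /predU1P[->|/outA //].
  by move: x2C; rewrite !inE negb_or => /andP[-> _].
- move=> i j v; rewrite /upd; case: eqP => [->|_]; case: eqP => [->|_] //.
  + rewrite inE => /predU1P[-> /x2out|]; [by rewrite eqxx | exact: ds].
  + move=> vi; rewrite inE => /predU1P[E|]; last exact: ds.
    by move: (x2out _ _ vi); rewrite E eqxx.
  + exact: ds.
- by rewrite updE; exists a; rewrite //= ax2.
- by rewrite updE /= x2C.
- by move=> j nj; rewrite updN //; split; [exact: eA | exact: all2].
Qed.

(** If [s j0] meets the boundary, its first boundary vertex [x2] and everything before it join the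
    center. This is a fork with [Q] reduced to [j0], as this cop keeps both [x] and [x2]. *)
Lemma winning_star_base F A x j0 s :
  star C F A x j0 s -> x \in boundary C -> winning C F.
Proof.
move=> st xC; have [S xA tj0 es kx cov] := st.
have [/split_find hs|] := boolP (has [in boundary C] (s j0)); last first.
  exact: winning_star_bare st xC.
have [x2 [p [p' [E x2C np]]]] : exists x2 p p',
    [/\ s j0 = rcons p x2 ++ p', x2 \in boundary C & ~~ has [in boundary C] p].
  by case: hs => x2 p p' x2C np; exists x2, p, p'.
have [C0 cC cA dCA us os ds vF fF ks] := S.
have tp : tail A (rcons p x2) by apply: (@tail_catl _ _ _ p'); rewrite -E.
have x2s : x2 \in s j0 by rewrite E mem_cat mem_rcons mem_head.
apply: (@winning_fork_core F (A :|: [set v in p]) x x2 j0 [set j0] (upd s j0 p')) => //.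
have AE : A :|: [set v in rcons p x2] = x2 |: (A :|: [set v in p]).
  by apply/setP => v; rewrite !inE mem_rcons inE orbCA.
split.
- by rewrite -AE; exact: system_grow S E tp.
- by apply: conn_tail => //; apply: (@tail_catl _ _ _ [:: x2]); rewrite cats1.
- by rewrite inE xA.
- have := os _ _ x2s; rewrite !inE !negb_or => /andP[_ ->] /=.
  by have := us j0; rewrite E cat_uniq rcons_uniq -!andbA => /andP[].
- exact: set11.
- rewrite updE; case: tj0 => a _; rewrite E cat_path last_rcons.
  by case/andP.
- by move=> j /set1P->; rewrite eqxx.
- move=> j; rewrite inE => nj; rewrite updN //.
  by case: (es j nj) => [|ej]; [left | right; apply: earS ej; exact: subsetUl].
- by move=> j /set1P->; split; [exact: kx | exact: ks x2s x2C].
- move=> v vC; have [->|[j vj]] := cov _ vC; first by constructor 1.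
  have [Ej|nj] := eqVneq j j0; last by constructor 3; exists j; rewrite updN.
  move: vj; rewrite Ej E mem_cat mem_rcons inE -orbA => /or3P[/eqP->|vp|vp'].
  + by constructor 2.
  + by case/hasP: np; exists v.
  + by constructor 3; exists j0; rewrite updE.
Qed.

Lemma boundary_neq0 x : C != set0 -> x \notin C -> exists v, v \in boundary C.
Proof.
case/set0Pn => u uC xC; have /connectP[p + xE] := connG u x.
rewrite {}xE in xC; elim: p u uC xC => [|z p IH] u uC /=; first by rewrite uC.
move=> lC /andP[uz pz]; have [zC|zC] := boolP (z \in C); first exact: (IH z).
by exists z; rewrite inE zC; apply/existsP; exists u; rewrite uC.
Qed.

(** When [x] is off the boundary, the center can absorb the path of the special cop up to its first
    boundary vertex, which takes the place of [x]. *)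
Lemma winning_star F A x j0 s : star C F A x j0 s -> winning C F.
Proof.
have main F' A' x' j s' : star C F' A' x' j s' -> has [in boundary C] (s' j) ->
    x' \notin boundary C -> winning C F'.
  move=> [S xA tj0 es kx cov] /split_find hs xC.
  have [y [p [p' [E yC np]]]] : exists y p p',
      [/\ s' j = rcons p y ++ p', y \in boundary C & ~~ has [in boundary C] p].
    by case: hs => y p p' yC np; exists y, p, p'.
  have tp : tail A' (rcons p y) by apply: (@tail_catl _ _ _ p'); rewrite -E.
  have ys : y \in s' j by rewrite E mem_cat mem_rcons mem_head.
  apply: (@winning_star_base F' (A' :|: [set v in rcons p y]) y j (upd s' j p')) => //.
  split.
  - exact: system_grow S E tp.
  - by rewrite !inE mem_rcons mem_head orbT.
  - rewrite updE; exists y; first by rewrite !inE mem_rcons mem_head orbT.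
    by case: tj0 => a _; rewrite E cat_path last_rcons; case/andP.
  - move=> i ni; rewrite updN //.
    by case: (es i ni) => [|ei]; [left | right; apply: earS ei; exact: subsetUl].
  - by move=> _; exact: (sys_keep S ys yC).
  - move=> v vC; have [Ev|[i vi]] := cov _ vC; first by rewrite -Ev vC in xC.
    have [Ei|ni] := eqVneq i j; last by right; exists i; rewrite updN.
    move: vi; rewrite Ei E mem_cat mem_rcons inE -orbA => /or3P[/eqP->|vp|vp'].
    + by left.
    + by case/hasP: np; exists v.
    + by right; exists j; rewrite updE.
move=> st; have [xC|xC] := boolP (x \in boundary C); first exact: winning_star_base st xC.
have [hj0|nj0] := boolP (has [in boundary C] (s j0)); first exact: main st hj0 xC.
have [S xA tj0 es kx cov] := st.
have xNC : x \notin C by apply/negP => /(disjointFr (sysCA S)); rewrite xA.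
have [v vC] := boundary_neq0 (sysC0 S) xNC.
have [Ev|[j vj]] := cov _ vC; first by rewrite -Ev vC in xC.
have nj : j != j0 by apply: contra nj0 => /eqP<-; apply/hasP; exists v.
(* Cop [j] takes over the role of [j0], its ear being in particular a tail; the old [j0] protects
   nothing and gets the empty path. *)
apply: (main F A x j (upd s j0 [::])) => //; last by rewrite updN //; apply/hasP; exists v.
split=> //.
- apply: (system_sub S) => i; rewrite /upd; case: ifP => // _; first exact: (sys_uniq S).
  by move.
- rewrite updN //; case: (es j nj) => [E|]; first by rewrite E in vj.
  by rewrite -{1}(cats0 (s j)); exact: ear_tail.
- move=> i ni; rewrite /upd; case: eqP => [|/eqP ni0]; [by left | exact: es].
- by move=> E; rewrite E in xC.
- move=> w wC; have [->|[i wi]] := cov _ wC; [by left | right; exists i].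
  by rewrite updN //; apply: contra nj0 => /eqP<-; apply/hasP; exists w.
Qed.

(** If [x1] or [x2] is off the boundary, then [x2 |: A] is the center of a star around the other
    one, and the paths of [Q] other than [s j0] become ears. *)
Lemma winning_fork F A x1 x2 j0 Q s : fork C F A x1 x2 j0 Q s -> winning C F.
Proof.
move=> fk; have [S cA x1A x2A j0Q tj0 eQ es kQ cov] := fk.
have [k1 k2] := kQ _ j0Q.
have base y : y \in x2 |: A -> keeps C (F j0) y ->
    (forall v, v \in boundary C -> v = y \/ exists j, v \in s j) -> winning C F.
  move=> yA ky covy; apply: (@winning_star F (x2 |: A) y j0 s); split=> //.
    by exists x2; first exact: setU11.
  move=> j nj; have [jQ|/es[->|ej]] := boolP (j \in Q); [right | by left | right].
    by have [a aA pa] := eQ _ jQ nj; exists x2, a; rewrite !inE eqxx aA orbT.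
  by apply: earS ej; exact: subsetUr.
have [x1C|x1C] := boolP (x1 \in boundary C); last first.
  apply: (base x2) => // [|v vC]; first exact: setU11.
  by have [E|->|h] := cov _ vC; [rewrite -E vC in x1C | left | right].
have [x2C|x2C] := boolP (x2 \in boundary C); first exact: winning_fork_core fk x1C x2C.
apply: (base x1) => // [|v vC]; first exact: setU1r.
by have [->|E|h] := cov _ vC; [left | rewrite -E vC in x2C | right].
Qed.

End Step.

(** * Induction on the size of the territory, and the start of the game *)

Lemma winning_star_fork C :
  (forall F A x j0 s, star C F A x j0 s -> winning C F) /\
  (forall F A x1 x2 j0 Q s, fork C F A x1 x2 j0 Q s -> winning C F).
Proof.
have [n] := ubnP #|C|; elim: n => // n IH in C *; rewrite ltnS => leCn.
have IH' D : D \proper C -> #|D| < n by move=> /proper_card lt; exact: leq_trans leCn.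
have IHs D F A x j0 s : D \proper C -> star D F A x j0 s -> winning D F.
  by move=> /IH'/IH[+ _]; exact.
have IHf D F A x1 x2 j0 Q s : D \proper C -> fork D F A x1 x2 j0 Q s -> winning D F.
  by move=> /IH'/IH[_]; exact.
split=> F A x *; first by apply: (winning_star IHs IHf); eassumption.
by apply: (winning_fork IHs IHf); eassumption.
Qed.

Lemma cops_win_minor_free (v : G) (j0 : 'I_K) : cops_win G K.
Proof.
apply: (@cops_win_of_wins G K [ffun=> v]) => r.
suff win : winning [set: G] (fun _ : 'I_K => fun=> v).
  by apply: win; rewrite ?inE // => i; rewrite ffunE /legal_move eqxx.
apply: (@winning_split _ _ _ _ [set v]) => [w /set1P->|D D0 sD cD bD]; first by exists j0.
have vD : v \notin D by apply/negP => /(subsetP sD); rewrite !inE eqxx.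
have [star_win _] := winning_star_fork D.
(* All cops stand on [v], which is the whole center, and all paths are empty. *)
apply: (star_win _ [set v] v j0 (fun=> [::])); split=> //; last 1 first.
- move=> w /bD[|/set1P]; last by left.
  by rewrite inE inE.
- split=> // [||_ r1 r2 _ _ _|_].
  + exact: conn1.
  + by rewrite disjoint_sym disjoints1.
  + by rewrite /legal_move eqxx.
  + by exists v; exact: leads_refl.
- exact: set11.
- by exists v; rewrite ?set11.
- by left.
- by move=> _; exact: leads_refl.
Qed.

End Chase.

(* [uphalf n] is the ceiling of n / 2. *)
Theorem corollary5p5 (t : nat) (ht : 1 <= t) (G : sgraph)
  (hconn : connected_graph G)
  (hfree : minor_free (complete_bipartite 2 t) G) :
  cop_number G <= uphalf t.+1.
Proof.
have le_cop m : cops_win G m -> cop_number G <= m.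
  by rewrite /cop_number; case: ex_minnP => n _ min_n wm; apply: min_n; apply/asboolP.
(* On the graph without vertices zero cops win vacuously. *)
case: (pickP (fun _ : G => true)) => [v _|G0]; last first.
  suff : cops_win G 0 by move/le_cop; rewrite leqn0 => /eqP->.
  exists (fun _ => [ffun i : 'I_0 => match notF (ltn_ord i) with end]) => [h r|rho _].
    by have := G0 r.
  by have := G0 (rho 0).
apply: le_cop; have K0 : 0 < uphalf t.+1 by [].
(* [uphalf t.+1] is the least [K] with [t <= 2 * K - 1]. *)
by apply: (cops_win_minor_free hconn _ hfree v (Ordinal K0)); lia.
Qed.
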